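(* Let $\mathfrak{G} = \widehat{\langle \varphi \rangle}$ be the profinite completion of an infinite cyclic group $\langle\varphi\rangle\simeq(\mathbb{Z},+)$. Locally finite $\mathfrak{G}$-modules $M$, $L$ admit a bijective $\mathfrak{G}$-equivariant map $\xi : M \rightarrow L$ if and only if their $\zeta$-functions $\zeta_M(t) = \zeta_L(t)$ coincide.
   Context: A $\mathfrak{G}$-module is a set with an action of $\mathfrak{G}$; it is locally finite if all $\mathfrak{G}$-orbits are finite and for every $n\in\mathbb{N}$ there are at most finitely many $\mathfrak{G}$-orbits of cardinality $n$. The degree $\deg\nu$ of an orbit $\nu$ is its cardinality. The $\zeta$-function of $M$ is the formal power series $\zeta_M(t)=\prod_\nu\frac{1}{1-t^{\deg\nu}}\in\mathbb{C}[[t]]$, the product over all $\mathfrak{G}$-orbits $\nu$ on $M$. *)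

(* Defs.v *)
From HB Require Import structures.
From mathcomp Require Import all_boot all_order all_algebra finmap.
From mathcomp Require Import all_classical all_reals.
From mathcomp Require Import complex zify.

Set Implicit Arguments.
Unset Strict Implicit.
Unset Printing Implicit Defensive.

Import Order.TTheory GRing.Theory Num.Theory.

Local Open Scope classical_set_scope.
Local Open Scope card_scope.

Section ProfiniteCompletion.
Variable C : groupType.
Local Open Scope group_scope.

(* [is_coset N A] : the set [A] is an element of the quotient C / N. *)
Definition is_coset (N A : set C) : Prop :=
  exists x : C, A = [set x * n | n in N].

Record fin_index_normal := FinIndexNormal {
  fin_set :> set C;
  fin_one : fin_set 1;
  fin_mul : forall x y, fin_set x -> fin_set y -> fin_set (x * y);
  fin_inv : forall x, fin_set x -> fin_set x^-1;
  fin_conj : forall x y, fin_set x -> fin_set (y^-1 * (x * y));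
  fin_index : finite_set [set A | is_coset fin_set A]
}.

(* The inverse limit of the quotients C / N over all normal subgroups N of
   finite index.  For N `<=` N' the projection C / N -> C / N' maps a coset to
   the unique coset of N' containing it; this gives the form of [pcompl_compat].
   The group law is the pointwise product of cosets. *)
Record profinite_completion := ProfiniteCompletion {
  pcompl_val :> fin_index_normal -> set C;
  pcompl_coset : forall N : fin_index_normal, is_coset N (pcompl_val N);
  pcompl_compat : forall N N' : fin_index_normal,
    N `<=` N' -> pcompl_val N `<=` pcompl_val N'
}.

HB.instance Definition _ := gen_eqMixin profinite_completion.
HB.instance Definition _ := gen_choiceMixin profinite_completion.

Lemma pcompl_eq (x y : profinite_completion) : (forall N, x N = y N) -> x = y.
Proof.
case: x y => [x cx mx] [y cy my] /= /funext exy.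
move: cx mx cy my; rewrite {}exy => cx mx cy my.
by rewrite (Prop_irrelevance cx cy) (Prop_irrelevance mx my).
Qed.

Lemma coset_mul (N : fin_index_normal) (x y : C) :
  [set a * b | a in [set x * n | n in N] & b in [set y * n | n in N]] =
  [set x * y * n | n in N].
Proof.
apply/seteqP; split => [_ [_ [n Nn <-] [_ [m Nm <-] <-]]|_ [n Nn <-]].
  exists (y^-1 * (n * y) * m); first by apply: fin_mul => //; exact: fin_conj.
  by rewrite !mulgA mulgK.
exists x; first by exists 1; rewrite ?mulg1 //; exact: fin_one.
by exists (y * n); [exists n|rewrite mulgA].
Qed.

Lemma coset_inv (N : fin_index_normal) (x : C) :
  [set a^-1 | a in [set x * n | n in N]] = [set x^-1 * n | n in N].
Proof.
apply/seteqP; split => [_ [_ [n Nn <-] <-]|_ [n Nn <-]].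
  exists (x * n^-1 * x^-1); last by rewrite invgM !mulgA mulVg mul1g.
  have := fin_conj x^-1 (fin_inv Nn).
  by rewrite invgK mulgA.
exists (n^-1 * x); last by rewrite invgM invgK.
exists (x^-1 * (n^-1 * x)); last by rewrite mulgA mulgV mul1g.
by apply: fin_conj; exact: fin_inv.
Qed.

Lemma pcompl_one_coset (N : fin_index_normal) : is_coset N N.
Proof.
exists 1; apply/seteqP; split => [x Nx|_ [x Nx <-]]; last by rewrite mul1g.
by exists x; rewrite ?mul1g.
Qed.

Definition pcompl_one : profinite_completion :=
  ProfiniteCompletion pcompl_one_coset (fun N N' NN' => NN').

Lemma pcompl_mul_coset (x y : profinite_completion) (N : fin_index_normal) :
  is_coset N [set a * b | a in x N & b in y N].
Proof.
have [a ->] := pcompl_coset x N; have [b ->] := pcompl_coset y N.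
by exists (a * b); rewrite coset_mul.
Qed.

Lemma pcompl_mul_compat (x y : profinite_completion)
    (N N' : fin_index_normal) : N `<=` N' ->
  [set a * b | a in x N & b in y N] `<=` [set a * b | a in x N' & b in y N'].
Proof.
move=> NN' _ [a xa [b yb <-]].
exists a; first exact: pcompl_compat xa.
by exists b => //; exact: pcompl_compat yb.
Qed.

Definition pcompl_mul (x y : profinite_completion) : profinite_completion :=
  ProfiniteCompletion (pcompl_mul_coset x y) (@pcompl_mul_compat x y).

Lemma pcompl_inv_coset (x : profinite_completion) (N : fin_index_normal) :
  is_coset N [set a^-1 | a in x N].
Proof. by have [a ->] := pcompl_coset x N; exists a^-1; rewrite coset_inv. Qed.

Lemma pcompl_inv_compat (x : profinite_completion)
    (N N' : fin_index_normal) : N `<=` N' ->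
  [set a^-1 | a in x N] `<=` [set a^-1 | a in x N'].
Proof. by move=> NN' _ [a xa <-]; exists a => //; exact: pcompl_compat xa. Qed.

Definition pcompl_inv (x : profinite_completion) : profinite_completion :=
  ProfiniteCompletion (pcompl_inv_coset x) (@pcompl_inv_compat x).

Lemma one_coset (N : fin_index_normal) : N = [set 1 * n | n in N] :> set C.
Proof. by under eq_imagel do rewrite mul1g; rewrite image_id. Qed.

Lemma pcompl_mulA : associative pcompl_mul.
Proof.
move=> x y z; apply: pcompl_eq => N /=.
have [a ->] := pcompl_coset x N; have [b ->] := pcompl_coset y N.
by have [c ->] := pcompl_coset z N; rewrite !coset_mul mulgA.
Qed.

Lemma pcompl_mul1 : left_id pcompl_one pcompl_mul.
Proof.
move=> x; apply: pcompl_eq => N /=; have [a ->] := pcompl_coset x N.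
by rewrite {1}(one_coset N) coset_mul mul1g.
Qed.

Lemma pcompl_mulr1 : right_id pcompl_one pcompl_mul.
Proof.
move=> x; apply: pcompl_eq => N /=; have [a ->] := pcompl_coset x N.
by rewrite {2}(one_coset N) coset_mul mulg1.
Qed.

Lemma pcompl_mulV : left_inverse pcompl_one pcompl_inv pcompl_mul.
Proof.
move=> x; apply: pcompl_eq => N /=; have [a ->] := pcompl_coset x N.
by rewrite coset_inv coset_mul mulVg -one_coset.
Qed.

Lemma pcompl_mulrV : right_inverse pcompl_one pcompl_inv pcompl_mul.
Proof.
move=> x; apply: pcompl_eq => N /=; have [a ->] := pcompl_coset x N.
by rewrite coset_inv coset_mul mulgV -one_coset.
Qed.

HB.instance Definition _ := isGroup.Build profinite_completion
  pcompl_mulA pcompl_mul1 pcompl_mulr1 pcompl_mulV pcompl_mulrV.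

(* C is infinite cyclic, generated by phi: k |-> phi^k is an isomorphism from
   (Z, +) onto C. *)
Definition infinite_cyclic_on (phi : C) : Prop :=
  exists f : int -> C,
    [/\ bijective f, {morph f : m n / (m + n)%R >-> m * n} & f 1%R = phi].

End ProfiniteCompletion.

Record gmodule (G : groupType) := GModule {
  gcarrier :> Type;
  gact : G -> gcarrier -> gcarrier;
  gact1 : forall x, gact 1%g x = x;
  gactM : forall (g h : G) x, gact (g * h)%g x = gact g (gact h x)
}.

Section Orbits.
Variables (G : groupType) (M : gmodule G).

Definition gorbit (x : M) : set M := [set gact g x | g in [set: G]].

Definition gorbits : set (set M) := [set gorbit x | x in [set: M]].

Definition locally_finite : Prop :=
  (forall nu, gorbits nu -> finite_set nu) /\
  (forall n : nat, finite_set [set nu | gorbits nu /\ nu #= `I_n]).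

End Orbits.

(* The number of elements of a finite set (and 0 for an infinite one). *)
Definition gdeg (T : Type) (A : set T) : nat := xget 0%N [set n | A #= `I_n].

Local Open Scope ring_scope.

Section PowerSeries.
Variable K : fieldType.

Record fps := Fps { fps_coef :> nat -> K }.

HB.instance Definition _ := gen_eqMixin fps.
HB.instance Definition _ := gen_choiceMixin fps.

Implicit Types a b c : fps.

Lemma fpsP a b : (forall n, a n = b n) -> a = b.
Proof. by case: a b => [a] [b] /= /funext ->. Qed.

Definition fps_zero := Fps (fun=> 0).
Definition fps_one := Fps (fun n => (n == 0%N)%:R).
Definition fps_add a b := Fps (fun n => a n + b n).
Definition fps_opp a := Fps (fun n => - a n).
Definition fps_mul a b := Fps (fun n => \sum_(i < n.+1) a i * b (n - i)%N).

Fact fps_addA : associative fps_add.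
Proof. by move=> a b c; apply: fpsP => n /=; rewrite addrA. Qed.
Fact fps_addC : commutative fps_add.
Proof. by move=> a b; apply: fpsP => n /=; rewrite addrC. Qed.
Fact fps_add0 : left_id fps_zero fps_add.
Proof. by move=> a; apply: fpsP => n /=; rewrite add0r. Qed.
Fact fps_addN : left_inverse fps_zero fps_opp fps_add.
Proof. by move=> a; apply: fpsP => n /=; rewrite addNr. Qed.

HB.instance Definition _ :=
  GRing.isZmodule.Build fps fps_addA fps_addC fps_add0 fps_addN.

Let trunc m a : {poly K} := \poly_(i < m) a i.

Let trunc_mul m n a b : (n < m)%N ->
  (trunc m a * trunc m b)`_n = fps_mul a b n.
Proof.
move=> nm; rewrite coefM /=; apply: eq_bigr => i _.
have im : (i < m)%N by rewrite (leq_trans (ltn_ord i)).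
by rewrite !coef_poly im (leq_ltn_trans (leq_subr i n) nm).
Qed.

Fact fps_mulC : commutative fps_mul.
Proof.
by move=> a b; apply: fpsP => n; rewrite -!(@trunc_mul n.+1) // mulrC.
Qed.

Fact fps_mulA : associative fps_mul.
Proof.
move=> a b c; apply: fpsP => n.
transitivity ((trunc n.+1 a * (trunc n.+1 b * trunc n.+1 c))`_n).
  rewrite coefM /=; apply: eq_bigr => i _; rewrite coef_poly ltn_ord.
  by rewrite (@trunc_mul n.+1) // ltnS leq_subr.
rewrite mulrA coefM /=; apply: eq_bigr => i _.
by rewrite coef_poly ltnS leq_subr (@trunc_mul n.+1).
Qed.

Fact fps_mul1 : left_id fps_one fps_mul.
Proof.
move=> a; apply: fpsP => n /=.
by rewrite big_ord_recl /= mul1r subn0 big1 ?addr0 // => i _; rewrite mul0r.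
Qed.

Fact fps_mulDl : left_distributive fps_mul fps_add.
Proof.
move=> a b c; apply: fpsP => n /=; rewrite -big_split /=.
by apply: eq_bigr => i _; rewrite mulrDl.
Qed.

Fact fps_one_neq0 : fps_one != 0.
Proof.
by apply/eqP => /(congr1 (fun a : fps => a 0%N)) /eqP; rewrite /= oner_eq0.
Qed.

HB.instance Definition _ := GRing.Zmodule_isComNzRing.Build fps
  fps_mulA fps_mulC fps_mul1 fps_mulDl fps_one_neq0.

Lemma fpsM a b n : (a * b) n = \sum_(i < n.+1) a i * b (n - i)%N.
Proof. by []. Qed.
Lemma fps1 n : (1 : fps) n = (n == 0%N)%:R. Proof. by []. Qed.
Lemma fps0 n : (0 : fps) n = 0. Proof. by []. Qed.
Lemma fpsD a b n : (a + b) n = a n + b n. Proof. by []. Qed.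
Lemma fpsN a n : (- a) n = - a n. Proof. by []. Qed.
Lemma fps_sum (I : Type) (r : seq I) (P : pred I) (F : I -> fps) n :
  (\sum_(i <- r | P i) F i) n = \sum_(i <- r | P i) F i n.
Proof. by elim/big_rec2: _ => // i y x _ <-. Qed.

Definition fpsC (k : K) : fps := Fps (fun n => if n is 0%N then k else 0).

Lemma fpsCM k a n : (fpsC k * a) n = k * a n.
Proof.
by rewrite fpsM big_ord_recl subn0 big1 ?addr0 // => i _; rewrite mul0r.
Qed.

Lemma fps_exp_low a n k : a 0%N = 0 -> (n < k)%N -> (a ^+ k) n = 0.
Proof.
move=> a0; elim: k n => // k IHk n nk; rewrite exprS fpsM big1 // => -[i /= li] _.
by case: i li => [|i] li; rewrite ?a0 ?mul0r // IHk ?mulr0 //; lia.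
Qed.

(* Inverse of a series with nonzero constant term a_0, as the geometric series
   a_0^-1 * \sum_k (1 - a_0^-1 a)^k; other series are not invertible and are
   left unchanged, following the convention of unitRingType. *)
Definition fps_unit : pred fps := fun a => a 0%N != 0.

Definition fps_inv a : fps :=
  if fps_unit a then
    fpsC (a 0%N)^-1 *
      Fps (fun n => \sum_(k < n.+1) ((1 - fpsC (a 0%N)^-1 * a) ^+ k) n)
  else a.

Fact fps_mulV : {in fps_unit, left_inverse 1 fps_inv *%R}.
Proof.
move=> a ua; rewrite /fps_inv ifT //; have {}ua : a 0%N != 0 by [].
set c := fpsC _; set u := 1 - _.
have u0 : u 0%N = 0.
  by rewrite fpsD fpsN fpsCM fps1 eqxx mulVf // subrr.
have ca : c * a = 1 - u by rewrite /u opprB addrC subrK.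
rewrite mulrAC ca; apply: fpsP => n.
transitivity (((1 - u) * \sum_(k < n.+1) u ^+ k) n).
  rewrite !fpsM; apply: eq_bigr => i _; congr (_ * _).
  rewrite fps_sum /= [in RHS](bigID (fun k : 'I_n.+1 => k < (n - i).+1)%N) /=.
  rewrite [X in _ = _ + X]big1 ?addr0 => [|k]; last first.
    by rewrite -leqNgt => ?; rewrite fps_exp_low.
  by rewrite (big_ord_widen n.+1 (fun k => (u ^+ k) (n - i)%N)) // ltnS leq_subr.
by rewrite -opprB mulNr -subrX1 opprB fpsD fpsN (@fps_exp_low _ _ n.+1) // subr0.
Qed.

Fact fps_unitP a b : b * a = 1 -> fps_unit a.
Proof.
move=> /(congr1 (fun c : fps => c 0%N)); rewrite fpsM big_ord1 fps1 eqxx.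
move=> ba; rewrite /fps_unit; apply/eqP => a0.
by move/eqP: ba; rewrite subn0 a0 mulr0 eq_sym oner_eq0.
Qed.

Fact fps_inv_out : {in [predC fps_unit], fps_inv =1 id}.
Proof. by move=> a /negPf ua; rewrite /fps_inv ifF. Qed.

HB.instance Definition _ := GRing.ComNzRing_hasMulInverse.Build fps
  fps_mulV fps_unitP fps_inv_out.

Definition fpsX : fps := Fps (fun n => (n == 1%N)%:R).

(* [P] is the product of the family [F] over the possibly infinite index set
   [A], for the t-adic topology: each coefficient of the finite subproducts is
   eventually constant along the directed set of finite subsets of [A]. *)
Definition fps_has_prod (I : choiceType) (A : set I) (F : I -> fps) (P : fps) :
    Prop :=
  forall n : nat, exists2 J : {fset I}, [set` J] `<=` A &
    forall S : {fset I}, [set` J] `<=` [set` S] -> [set` S] `<=` A ->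
      (\prod_(i <- S) F i) n = P n.

Definition fps_prod (I : choiceType) (A : set I) (F : I -> fps) : fps :=
  xget 0 (fps_has_prod A F).

Lemma fps_has_prod_unique (I : choiceType) (A : set I) (F : I -> fps) P Q :
  fps_has_prod A F P -> fps_has_prod A F Q -> P = Q.
Proof.
move=> hP hQ; apply: fpsP => n.
have [J JA {}hP] := hP n; have [L LA {}hQ] := hQ n.
rewrite -(hP (J `|` L)%fset) ?(hQ (J `|` L)%fset) //.
- by move=> i /= iL; rewrite inE iL orbT.
- by move=> i /=; rewrite inE => /orP[/JA|/LA].
- by move=> i /= iJ; rewrite inE iJ.
- by move=> i /=; rewrite inE => /orP[/JA|/LA].
Qed.

End PowerSeries.

Section Zeta.
Variables (R : realType) (G : groupType) (M : gmodule G).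

Definition zeta : fps R[i] :=
  fps_prod (@gorbits G M) (fun nu => (1 - fpsX _ ^+ gdeg nu)^-1).

End Zeta.

Lemma gdegP (T : Type) (A : set T) : finite_set A -> A #= `I_(gdeg A).
Proof. by move=> fA; apply: (xgetPex 0%N fA). Qed.

Lemma gdeg_gt0 (G : groupType) (M : gmodule G) (nu : set M) :
  gorbits nu -> finite_set nu -> (0 < gdeg nu)%N.
Proof.
move=> [x _ <-] /gdegP; rewrite lt0n; case: eqP => // ->.
rewrite II0 card_eq0 => /eqP x0.
by have : gorbit x (gact 1%g x) by [exists 1%g]; rewrite x0.
Qed.

Section ZetaConvergence.
Variable K : fieldType.
Implicit Types a b : fps K.

Lemma fps_mul_low a b n : (forall k, (k <= n)%N -> b k = (k == 0%N)%:R) ->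
  forall k, (k <= n)%N -> (a * b) k = a k.
Proof.
move=> hb k kn; rewrite mulrC fpsM big_ord_recl hb // mul1r subn0 big1 ?addr0 //.
by move=> i _; rewrite hb ?mul0r //= (leq_trans (ltn_ord i)).
Qed.

Lemma fps_geom_low d n : (n < d)%N ->
  forall k, (k <= n)%N -> (1 - fpsX K ^+ d)^-1 k = (k == 0%N)%:R.
Proof.
move=> nd k kn; have e0 j : (j <= n)%N -> (fpsX K ^+ d) j = 0.
  by move=> jn; rewrite fps_exp_low // (leq_ltn_trans jn).
have ue : 1 - fpsX K ^+ d \is a GRing.unit.
  by rewrite unfold_in /= /fps_unit fpsD fpsN e0 // subr0 fps1 oner_neq0.
rewrite -(@fps_mul_low _ (1 - fpsX K ^+ d) n) // => [|j jn].
  by rewrite mulVr.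
by rewrite fpsD fpsN e0 // subr0 fps1.
Qed.

End ZetaConvergence.

(* For locally finite M the product defining [zeta] converges, so [zeta] is not
   the default value of [fps_prod]. *)
Lemma zetaP (R : realType) (G : groupType) (M : gmodule G) : locally_finite M ->
  fps_has_prod (@gorbits G M) (fun nu => (1 - fpsX R[i] ^+ gdeg nu)^-1)
    (zeta R M).
Proof.
move=> [fin1 fin2]; apply: (@xgetPex _ 0 (fps_has_prod _ _)).
pose B n := [set nu | @gorbits G M nu /\ (gdeg nu <= n)%N].
have finB n : finite_set (B n).
  apply: (@sub_finite_set _ _
    (\bigcup_(k in `I_n.+1) [set nu | @gorbits G M nu /\ nu #= `I_k])).
    move=> nu [nuM nun]; exists (gdeg nu) => //=.
    by split=> //; apply: gdegP; exact: fin1.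
  by apply: bigcup_finite.
exists (Fps (fun n => (\prod_(nu <- fset_set (B n))
  (1 - fpsX R[i] ^+ gdeg nu)^-1) n)) => n.
exists (fset_set (B n)).
  by move=> nu /=; rewrite in_fset_set // inE => -[].
move=> S BS SM /=; rewrite (big_fsetID _ (mem (fset_set (B n)))) /=.
have -> : [fset x in S | x \in fset_set (B n)]%fset = fset_set (B n).
  apply/fsetP => x; rewrite !inE /= andbC.
  by case: (boolP (x \in fset_set (B n))) => //= /BS.
apply: (@fps_mul_low _ _ _ n) => //.
rewrite big_seq; elim/big_ind: _ => [//|a b ha hb k kn|nu].
  by rewrite (@fps_mul_low _ _ _ n) // ha.
rewrite !inE /= => /andP[/SM nuM]; rewrite in_fset_set // => nuB.
apply: fps_geom_low; rewrite ltnNge; apply: contra nuB => nun.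
by rewrite inE.
Qed.

(* Main.v *)
Require Import Defs.
From mathcomp Require Import all_boot all_order all_algebra finmap.
From mathcomp Require Import all_classical all_reals.
From mathcomp Require Import complex zify.

(** Let Z^ be the profinite completion of the infinite cyclic group, generated
    by phi = f 1 with f : Z -> C an isomorphism.  An orbit of a group is
    determined up to isomorphism by the stabilizer of one of its points.  For
    Z^ the stabilizer of a point in a finite orbit depends only on the size n
    of the orbit ([stab_card]), so M and L are isomorphic exactly when, for
    every n, they have equally many orbits of size n; and these numbers are
    what the zeta function records ([zeta_eqP]).  An equivariant bijection
    clearly preserves them; the content lies in the converse.

    Z^ acts as an abstract group, so it has to be proved, not read off from a
    topology, that it acts on a finite orbit through powers of phi.  Every element of Z^ that is
    trivial modulo m-th powers is itself an m-th power ([pcompl_root]): an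
    m-th root can be read off coset by coset because C is commutative and
    torsion-free.  Hence every g in Z^ is phi^k h^m for some integer k
    ([pcompl_factor]).  With m = n!, the factor h^m fixes every point whose
    orbit has size n ([gact_fact]), so g acts there as phi^k does.  The orbit
    is thus a single cycle of phi of length n, and phi^k h^m fixes the point
    iff n divides k ([pcompl_in_fix]): a condition on n alone.

    Up to degree n the zeta function agrees with the finite product over the
    orbits of degree at most n ([zeta_part_coef]).  Passing from n to n+1
    multiplies that product by (1 - t^(n+1))^(-a), where a counts the orbits of
    degree n+1, which adds a to the coefficient of t^(n+1)
    ([fps_mul_geomX]).  By induction, since the coefficient field has
    characteristic zero, the zeta function determines every a.  Equal counts
    match the orbits of M and L degree by degree ([orbits_deg_bij]), and
    matched orbits, having the same stabilizers, assemble into an equivariant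
    bijection ([transversal_iso]). *)

Set Implicit Arguments.
Unset Strict Implicit.
Unset Printing Implicit Defensive.

Import Order.TTheory GRing.Theory Num.Theory.

Local Open Scope classical_set_scope.
Local Open Scope card_scope.

(** * Elements of a profinite completion *)

Section Completion.
Variable C : groupType.
Local Open Scope group_scope.

Local Notation Ch := (profinite_completion C).

Lemma coset_of_mem (N : fin_index_normal C) (A : set C) (a : C) :
  is_coset N A -> A a -> A = [set a * n | n in N].
Proof.
move=> [x ->] [n Nn <-]; apply/seteqP; split => _ [p Np <-].
  exists (n^-1 * p); first by apply: fin_mul => //; exact: fin_inv.
  by rewrite !mulgA mulgK.
by exists (n * p); [exact: fin_mul|rewrite mulgA].
Qed.

Lemma pcompl_mem (g : Ch) N : exists a, g N a.
Proof.
have [a ->] := pcompl_coset g N.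
by exists (a * 1); exists 1 => //; exact: fin_one.
Qed.

Lemma pcomplM (g h : Ch) N a b : g N a -> h N b -> (g * h)%g N (a * b).
Proof. by move=> ga hb; exists a => //; exists b. Qed.

Lemma pcomplV (g : Ch) N a : g N a -> (g^-1)%g N a^-1.
Proof. by move=> ga; exists a. Qed.

Lemma pcomplX (g : Ch) N a m : g N a -> (g ^+ m)%g N (a ^+ m).
Proof.
move=> ga; elim: m => [|m IH]; first exact: fin_one.
by rewrite !expgS; exact: pcomplM.
Qed.

(** Cosets are equal as soon as they meet, so equality in the completion can be
    tested on one representative at each finite level. *)
Lemma pcompl_eq_mem (g h : Ch) : (forall N, exists2 a, g N a & h N a) -> g = h.
Proof.
move=> gh; apply: pcompl_eq => N; have [a ga ha] := gh N.
by rewrite (coset_of_mem (pcompl_coset g N) ga)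
  (coset_of_mem (pcompl_coset h N) ha).
Qed.

Lemma pcompl_in_coset (c : C) (N : fin_index_normal C) :
  is_coset N [set c * n | n in N].
Proof. by exists c. Qed.

Lemma pcompl_in_compat (c : C) (N N' : fin_index_normal C) : N `<=` N' ->
  [set c * n | n in N] `<=` [set c * n | n in N'].
Proof. by move=> NN' _ [n Nn <-]; exists n => //; exact: NN'. Qed.

(** The canonical map from C to its profinite completion. *)
Definition pcompl_in (c : C) : Ch :=
  ProfiniteCompletion (pcompl_in_coset c) (@pcompl_in_compat c).

Lemma pcompl_in_mem c N : pcompl_in c N c.
Proof. by exists 1; rewrite ?mulg1 //; exact: fin_one. Qed.

Lemma pcompl_inM : {morph pcompl_in : a b / a * b}.
Proof.
move=> a b; apply: pcompl_eq_mem => N; exists (a * b).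
  exact: pcompl_in_mem.
by apply: pcomplM; exact: pcompl_in_mem.
Qed.

End Completion.

(** * The profinite completion of an infinite cyclic group *)

Lemma int_edivn d (k : int) : (0 < d)%N ->
  exists i q, (i < d)%N /\ k = (Posz i + Posz d * q)%R.
Proof.
move=> d0; have dn0 : Posz d != 0%R by lia.
have r0 := modz_ge0 k dn0; have rd := ltz_pmod k (ltac:(lia) : (0 < Posz d)%R).
by exists `|(k %% d)%Z|%N, (k %/ d)%Z; have := divz_eq k d; lia.
Qed.

Section Cyclic.
Variables (C : groupType) (f : int -> C).
Hypothesis f_bij : bijective f.
Hypothesis fD : {morph f : m n / (m + n)%R >-> (m * n)%g}.
Local Open Scope group_scope.

Local Notation Ch := (profinite_completion C).

Lemma cyc0 : f 0%R = 1.
Proof. by apply: (mulgI (f 0%R)); rewrite -fD addr0 mulg1. Qed.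

Lemma cycN k : f (- k)%R = (f k)^-1.
Proof. by apply: (mulgI (f k)); rewrite -fD subrr cyc0 mulgV. Qed.

Lemma cycX k n : f (k *+ n)%R = f k ^+ n.
Proof. by elim: n => [|n IH]; rewrite ?mulr0n ?cyc0 // mulrS fD IH expgS. Qed.

Lemma cyc_surj c : exists k, f k = c.
Proof. by case: f_bij => g _ gK; exists (g c). Qed.

Lemma cyc_comm (a b : C) : a * b = b * a.
Proof.
have [k <-] := cyc_surj a; have [l <-] := cyc_surj b.
by rewrite -!fD addrC.
Qed.

Lemma cyc_expI m : (0 < m)%N -> injective (fun c : C => c ^+ m).
Proof.
move=> m0 a b; have [k <-] := cyc_surj a; have [l <-] := cyc_surj b.
rewrite -!cycX => /(bij_inj f_bij) kl; congr (f _).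
by move: kl; rewrite -(mulr_natr k) -(mulr_natr l); apply: mulIf; rewrite pnatr_eq0 -lt0n.
Qed.

(** Two of the infinitely many powers of the generator lie in the same coset. *)
Lemma fin_index_cyc (N : fin_index_normal C) :
  exists2 d : nat, (0 < d)%N & fin_set N (f (Posz d)).
Proof.
pose F (i : nat) := [set f (Posz i) * n | n in N].
apply: contrapT => /forall2NP noN.
have Finj : injective F.
  move=> i j; wlog ij : i j / (i <= j)%N.
    move=> H Fij; case: (leqP i j) => [/H|/ltnW /H]; first exact.
    by move=> ->.
  move=> Fij; apply/eqP; rewrite eqn_leq ij leqNgt; apply/negP => lij.
  have : F j (f (Posz j)) by exists 1; [exact: fin_one|rewrite mulg1].
  rewrite -Fij => -[n Nn fij]; case: (noN (j - i)%N); first by rewrite subn_gt0.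
  suff <- : n = f (Posz (j - i)) by [].
  by apply: (mulgI (f (Posz i))); rewrite fij -fD; congr f; lia.
have := @infinite_nat; apply.
have : finite_set (F @` [set: nat]).
  apply: sub_finite_set (fin_index N) => _ [i _ <-].
  by exists (f (Posz i)).
by move=> /(finite_preimage (in2W Finj)); apply: sub_finite_set => i _; exists i.
Qed.

Section Subgroup.
Variable (H : set C).
Hypotheses (H1 : H 1) (HM : forall x y, H x -> H y -> H (x * y))
  (HV : forall x, H x -> H x^-1).
Variables (d : nat).
Hypotheses (d0 : (0 < d)%N) (Hd : H (f (Posz d))).

Lemma subgroup_mul (z : int) : H (f (Posz d * z)%R).
Proof.
case: z => n.
  by elim: n => [|n IH]; rewrite ?mulr0 ?cyc0 // intS mulrDr mulr1 fD; exact: HM.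
rewrite NegzE mulrN cycN; apply: HV.
by elim: n.+1 => [|p IH]; rewrite ?mulr0 ?cyc0 // intS mulrDr mulr1 fD; exact: HM.
Qed.

Lemma subgroup_conj x y : H x -> H (y^-1 * (x * y)).
Proof. by rewrite (cyc_comm x) mulgA mulVg mul1g. Qed.

(** H contains all phi^(dq), so the powers phi^i with i < d represent all cosets. *)
Lemma subgroup_fin_index : finite_set [set A | is_coset H A].
Proof.
apply: (@sub_finite_set _ _
  ((fun i : nat => [set f (Posz i) * n | n in H]) @` `I_d)); last first.
  exact: finite_image.
move=> _ [x ->]; have [k <-] := cyc_surj x.
have [i [q [id ->]]] := int_edivn k d0; exists i => //.
apply/seteqP; split => _ [n Hn <-].
  exists (f (Posz d * - q)%R * n); first by apply: HM => //; exact: subgroup_mul.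
  by rewrite mulgA -fD; congr (f _ * _); lia.
exists (f (Posz d * q)%R * n); first by apply: HM => //; exact: subgroup_mul.
by rewrite mulgA -fD.
Qed.

Definition subgroup_normal : fin_index_normal C :=
  FinIndexNormal H1 HM HV subgroup_conj subgroup_fin_index.

End Subgroup.

Definition full_normal : fin_index_normal C :=
  @subgroup_normal setT I (fun _ _ _ _ => I) (fun _ _ => I) 1 isT I.

(** Raising N to the m-th power keeps the index finite: if N contains phi^d, the
    image contains phi^(dm). *)
Lemma pow_normal_ex (N : fin_index_normal C) m : (0 < m)%N ->
  exists P : fin_index_normal C, P = [set c ^+ m | c in N] :> set C.
Proof.
move=> m0; have [d d0 Nd] := fin_index_cyc N.
unshelve eexists (@subgroup_normal [set c ^+ m | c in N] _ _ _ (d * m) _ _) => //.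
- by exists 1; [exact: fin_one|rewrite expg1n].
- move=> _ _ [a Na <-] [b Nb <-]; exists (a * b); first exact: fin_mul.
  by rewrite expgMn //; exact: cyc_comm.
- by move=> _ [a Na <-]; exists a^-1; [exact: fin_inv|rewrite expVgn].
- by rewrite muln_gt0 d0.
- by exists (f (Posz d)) => //; rewrite -cycX; congr f; lia.
Qed.

(** The root h is defined at level K by c \in h K iff c^m \in g K^m, where K^m is
    the group of m-th powers of K, again of finite index.  This set is a single
    coset: g is trivial modulo m-th powers, so its value at K^m is b^m K^m for
    some b, and m-th roots in C are unique. *)
Lemma pcompl_root (g : Ch) m (N : fin_index_normal C) : (0 < m)%N ->
  N = [set c ^+ m | c in setT] :> set C -> g N 1 -> exists h : Ch, g = h ^+ m.
Proof.
move=> m0 NE g1.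
(* P K is the group of m-th powers of K. *)
have [P PE] := choice (fun N => pow_normal_ex N m0).
have gb K : exists b, g (P K) (b ^+ m).
  have [a ga] := pcompl_mem g (P K).
  have PN : P K `<=` N by rewrite PE NE => _ [c _ <-]; exists c.
  have := pcompl_compat PN ga.
  rewrite (coset_of_mem (pcompl_coset g N) g1) => -[n].
  by rewrite NE mul1g => -[b _ <-] ba; exists b; rewrite ba.
have hc (K : fin_index_normal C) : is_coset K [set c | g (P K) (c ^+ m)].
  have [b gbK] := gb K; exists b.
  rewrite (coset_of_mem (pcompl_coset g (P K)) gbK).
  apply/seteqP; split => c /=; last first.
    move=> [n Kn <-]; exists (n ^+ m); first by rewrite PE; exists n.
    by rewrite expgMn //; exact: cyc_comm.
  rewrite PE => -[_ [n Kn <-] bn]; exists n => //; apply: (cyc_expI m0).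
  by rewrite /= -bn expgMn //; exact: cyc_comm.
have hm (K K' : fin_index_normal C) : K `<=` K' ->
    [set c | g (P K) (c ^+ m)] `<=` [set c | g (P K') (c ^+ m)].
  move=> KK' c /=; apply: pcompl_compat.
  by rewrite !PE => _ [a Ka <-]; exists a => //; exact: KK'.
(* The m-th power of h at K and g at K meet in b^m, where b^m represents g
   at the smaller group K^m. *)
exists (ProfiniteCompletion hc hm); apply: pcompl_eq_mem => K.
have [b gbK] := gb K; exists (b ^+ m); last exact: pcomplX.
apply: pcompl_compat gbK.
rewrite PE => _ [c Kc <-]; elim: (m) => [|p IH]; first exact: fin_one.
by rewrite expgS; exact: fin_mul.
Qed.

Lemma pcompl_factor m (g : Ch) : (0 < m)%N ->
  exists k (h : Ch), g = pcompl_in (f k) * h ^+ m.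
Proof.
move=> m0; have [N NE] := pow_normal_ex full_normal m0.
have [c gc] := pcompl_mem g N; have [k kc] := cyc_surj c.
have [|h hE] := @pcompl_root ((pcompl_in (f k))^-1 * g) _ _ m0 NE.
  rewrite -(mulVg c); apply: pcomplM => //.
  by apply: pcomplV; rewrite kc; exact: pcompl_in_mem.
by exists k, h; rewrite -hE mulgA mulgV mul1g.
Qed.

Section Orbit.
Variables (M : gmodule Ch) (x : M) (n : nat).
Hypothesis xn : gorbit x #= `I_n.

(** Among the n + 1 points h^i x with i <= n two coincide, so some h^e with
    0 < e <= n fixes x, and e divides n!. *)
Lemma gact_fact (h : Ch) : gact (h ^+ n`!) x = x.
Proof.
pose F i := gact (h ^+ i) x.
have [i [j [ij jn Fij]]] : exists i j, [/\ (i < j)%N, (j <= n)%N & F i = F j].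
  apply: contrapT => nF.
  have Finj : {in `I_n.+1 &, injective F}.
    move=> i j; rewrite !inE /= !ltnS => iN jN Fij.
    apply: contrapT => /eqP; rewrite neq_ltn => /orP[] lt; apply: nF.
      by exists i, j.
    by exists j, i.
  have : F @` `I_n.+1 #<= gorbit x.
    by apply: subset_card_le => _ [i _ <-]; exists (h ^+ i).
  by rewrite (card_le_eql (inj_card_eq Finj)) (card_le_eqr xn) card_le_II ltnn.
have e0 : (0 < j - i)%N by rewrite subn_gt0.
have fix_e : gact (h ^+ (j - i)) x = x.
  have : gact (h ^- i) (F i) = gact (h ^- i) (F j) by rewrite Fij.
  rewrite /F -!gactM mulVg gact1 => {2}->.
  by rewrite -{2}(subnKC (ltnW ij)) expgnDr mulgA mulVg mul1g.
have /dvdnP[q ->] : (j - i %| n`!)%N.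
  by apply: dvdn_fact; rewrite e0 (leq_trans (leq_subr _ _)).
rewrite mulnC expgnA; elim: q => [|q IH]; first by rewrite expg0 gact1.
by rewrite expgSr gactM fix_e.
Qed.

Lemma gact_factor k (h : Ch) :
  gact (pcompl_in (f k) * h ^+ n`!) x = gact (pcompl_in (f k)) x.
Proof. by rewrite gactM gact_fact. Qed.

Let P : set int := [set k | gact (pcompl_in (f k)) x = x].

Let P0 : P 0%R.
Proof.
rewrite /P /= cyc0 (_ : pcompl_in 1 = 1) ?gact1 //.
by apply: (mulgI (pcompl_in 1)); rewrite -pcompl_inM !mulg1.
Qed.

Let PD k l : P k -> P l -> P (k + l)%R.
Proof. by rewrite /P /= fD pcompl_inM gactM => pk ->. Qed.

Let PE k l : gact (pcompl_in (f k)) x = gact (pcompl_in (f l)) x <-> P (k - l)%R.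
Proof.
rewrite /P /= addrC fD pcompl_inM gactM; split => [->|H].
  by have := P0; rewrite /P /= -(addNr l) fD pcompl_inM gactM.
rewrite -[in RHS]H -gactM -pcompl_inM -fD subrr.
by rewrite -!gactM -pcompl_inM -fD add0r.
Qed.

Let PN k : P k -> P (- k)%R.
Proof. by move=> pk; rewrite -(add0r (- k)%R); apply/PE; rewrite pk; exact: P0. Qed.

Let PM k z : P k -> P (k * z)%R.
Proof.
move=> pk; have Pn n' : P (k * Posz n')%R.
  by elim: n' => [|p IH]; rewrite ?mulr0 // intS mulrDr mulr1; exact: PD.
by case: z => p //; rewrite NegzE mulrN; exact: PN.
Qed.

(** The exponents k with phi^k x = x form a subgroup d Z.  Since every g acts on x
    as a power of phi, the orbit consists of the d points phi^i x with i < d,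
    and so d = n. *)
Lemma pcompl_in_fix k : gact (pcompl_in (f k)) x = x <-> (n %| k)%Z.
Proof.
have ex_d : exists d : nat, (0 < d)%N && `[< P (Posz d) >].
  exists n`!; rewrite fact_gt0; apply/asboolP.
  rewrite /P /= (_ : Posz n`! = (1 *+ n`!)%R) ?cycX; last by lia.
  have -> : pcompl_in (f 1%R ^+ n`!) = pcompl_in (f 1%R) ^+ n`!.
    apply: pcompl_eq_mem => N; exists (f 1%R ^+ n`!); first exact: pcompl_in_mem.
    by apply: pcomplX; exact: pcompl_in_mem.
  exact: gact_fact.
case: (ex_minnP ex_d) => d /andP[d0 /asboolP Pd] dmin.
have Pdvd l : P l <-> (d %| l)%Z.
  split => [Pl|/dvdzP[q ->]]; last by rewrite mulrC; exact: PM.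
  have [i [q [id lE]]] := int_edivn l d0.
  have Pi : P (Posz i).
    have -> : Posz i = (l + Posz d * - q)%R by rewrite lE; lia.
    by apply: PD => //; exact: PM.
  case: i => [|i] in id lE Pi *; first by apply/dvdzP; exists q; lia.
  by have := dmin i.+1; rewrite asboolT // => /(_ isT); lia.
suff <- : d = n by exact: Pdvd.
apply/card_eq_II; apply: card_eq_trans xn.
pose F (i : nat) := gact (pcompl_in (f (Posz i))) x.
have -> : gorbit x = F @` `I_d.
  apply/seteqP; split => [_ [g _ <-]|_ [i _ <-]]; last by exists (pcompl_in (f (Posz i))).
  have [l [h ->]] := pcompl_factor g (fact_gt0 n).
  have [i [q [id ->]]] := int_edivn l d0; exists i => //.
  by rewrite gact_factor; apply/PE/Pdvd; apply/dvdzP; exists (- q)%R; lia.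
rewrite card_eq_sym; apply: inj_card_eq => i j; rewrite !inE /= => id jd.
move=> /PE /Pdvd /dvdzP[q ijq].
have [q0|[q1|q1]] : (q = 0 \/ q <= -1 \/ 1 <= q)%R by lia.
- by move: ijq; rewrite q0 mul0r; lia.
- by nia.
- by nia.
Qed.

End Orbit.

(** Both conditions say that n divides k, where g = phi^k h^(n!). *)
Lemma stab_card (M L : gmodule Ch) (x : M) (y : L) n g :
  gorbit x #= `I_n -> gorbit y #= `I_n ->
  gact g x = x <-> gact g y = y.
Proof.
move=> xn yn; have [k [h ->]] := pcompl_factor g (fact_gt0 n).
by rewrite !(gact_factor (n := n)) // (pcompl_in_fix xn) (pcompl_in_fix yn).
Qed.

End Cyclic.

(** * Equivariant bijections from orbit representatives *)

Section Transversal.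
Variable G : groupType.
Local Open Scope group_scope.

Definition transversal (M : gmodule G) (I : Type) (p : I -> M) : Prop :=
  (forall x, exists i, gorbit (p i) x) /\
  (forall i j, gorbit (p j) (p i) -> i = j).

(** The rule g (p i) |-> g (q i) is well defined because i is determined by
    g (p i), and g up to the stabilizer of p i. *)
Lemma transversal_ext (M L : gmodule G) (I : Type) (p : I -> M) (q : I -> L) :
  transversal p ->
  (forall i g, gact g (p i) = p i -> gact g (q i) = q i) ->
  exists xi : M -> L, forall i g, xi (gact g (p i)) = gact g (q i).
Proof.
move=> [pT pI] stab.
have /choice[s sE] : forall x, exists s : I * G, gact s.2 (p s.1) = x.
  by move=> x; have [i [g _ <-]] := pT x; exists (i, g).
exists (fun x => gact (s x).2 (q (s x).1)) => i g.
move: (sE (gact g (p i))); case: (s _) => j h /= hE.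
have gh : gact (g^-1 * h) (p j) = p i by rewrite gactM hE -gactM mulVg gact1.
have ij : i = j by apply: pI; exists (g^-1 * h).
rewrite -{}ij {j} in hE gh *.
by rewrite -{2}(stab _ _ gh) -gactM mulgA mulgV mul1g.
Qed.

Lemma transversal_iso (M L : gmodule G) (I : Type) (p : I -> M) (q : I -> L) :
  transversal p -> transversal q ->
  (forall i g, gact g (p i) = p i <-> gact g (q i) = q i) ->
  exists xi : M -> L, bijective xi /\
    forall (g : G) (x : M), xi (gact g x) = gact g (xi x).
Proof.
move=> pT qT stab.
have [xi xiE] := transversal_ext pT (fun i g => (stab i g).1).
have [ix ixE] := transversal_ext qT (fun i g => (stab i g).2).
exists xi; split=> [|g x].
  exists ix => x.
    by have [i [g _ <-]] := pT.1 x; rewrite xiE ixE.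
  by have [i [g _ <-]] := qT.1 x; rewrite ixE xiE.
by have [i [h _ <-]] := pT.1 x; rewrite -gactM !xiE gactM.
Qed.

Lemma gorbit_refl (M : gmodule G) (x : M) : gorbit x x.
Proof. by exists 1; rewrite ?gact1. Qed.

Lemma gorbit_eq (M : gmodule G) (x y : M) : gorbit x y -> gorbit y = gorbit x.
Proof.
move=> [g _ <-]; apply/seteqP; split => _ [h _ <-].
  by exists (h * g); rewrite ?gactM.
by exists (h * g^-1); rewrite // -gactM -mulgA mulVg mulg1.
Qed.

Lemma transversal_orbits (M : gmodule G) (I : Type) (p : I -> M)
    (o : I -> set M) : (forall i, gorbit (p i) = o i) ->
  set_bij [set: I] (@gorbits G M) o -> transversal p.
Proof.
move=> po [_ oI oS]; split=> [x|i j /gorbit_eq pij].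
  have [|i _ oi] := oS (gorbit x); first by exists x.
  by exists i; rewrite po oi; exact: gorbit_refl.
by apply: oI; rewrite ?inE // -!po.
Qed.

End Transversal.

(** * Orbits of a given degree *)

Definition orbits_deg (G : groupType) (M : gmodule G) (n : nat) : set (set M) :=
  [set nu | @gorbits G M nu /\ gdeg nu = n].
Arguments orbits_deg {G} M n.

Definition orbits_le (G : groupType) (M : gmodule G) (n : nat) : set (set M) :=
  [set nu | @gorbits G M nu /\ (gdeg nu <= n)%N].
Arguments orbits_le {G} M n.

Lemma gdeg_card_eq (T U : Type) (A : set T) (B : set U) :
  A #= B -> gdeg A = gdeg B.
Proof.
move=> AB; rewrite /gdeg; congr (xget _ _); apply/funext => n /=.
by apply/propext; split; apply: card_eq_trans; rewrite // card_eq_sym.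
Qed.

(** The bijections between orbits of each degree glue, since the degree of an
    orbit tells which of them to use. *)
Lemma orbits_deg_bij (G : groupType) (M L : gmodule G) :
  (forall n, orbits_deg M n #= orbits_deg L n) ->
  exists2 s : set M -> set L, set_bij (@gorbits G M) (@gorbits G L) s &
    forall nu, gorbits nu -> gdeg (s nu) = gdeg nu.
Proof.
move=> ML.
have /choice[t tbij] : forall n, exists t, set_bij (orbits_deg M n) (orbits_deg L n) t.
  by move=> n; exact/card_set_bijP.
have tdeg nu : gorbits nu -> orbits_deg L (gdeg nu) (t (gdeg nu) nu).
  by move=> nuM; have [tF _ _] := tbij (gdeg nu); apply: tF.
exists (fun nu => t (gdeg nu) nu); last by move=> nu /tdeg[].
split=> [nu /tdeg[]//|nu nu'|mu muL].
  rewrite !inE => nuM nuM' tE; have [_ d] := tdeg _ nuM; have [_ d'] := tdeg _ nuM'.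
  have dd : gdeg nu = gdeg nu' by rewrite -d tE.
  have [_ tI _] := tbij (gdeg nu).
  by apply: tI; rewrite ?inE // tE dd.
have [_ _ tS] := tbij (gdeg mu).
by have [nu [nuM d] <-] := tS mu (conj muL erefl); exists nu; rewrite // d.
Qed.

Section Equivariant.
Variables (G : groupType) (M L : gmodule G) (xi : M -> L).
Hypotheses (xi_bij : bijective xi)
  (xi_act : forall (g : G) x, xi (gact g x) = gact g (xi x)).

Lemma image_gorbit x : xi @` gorbit x = gorbit (xi x).
Proof.
apply/seteqP; split => [_ [_ [g _ <-] <-]|_ [g _ <-]].
  by exists g; rewrite ?xi_act.
by exists (gact g x) => //; exists g.
Qed.

Lemma orbits_deg_card n : orbits_deg M n #= orbits_deg L n.
Proof.
have degE (nu : set M) : gdeg (xi @` nu) = gdeg nu.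
  by apply: gdeg_card_eq; apply: inj_card_eq; apply: in2W; exact: bij_inj.
have -> : orbits_deg L n = (fun nu => xi @` nu) @` orbits_deg M n.
  apply/seteqP; split => [_ [[y _ <-] dn]|_ [_ [[x _ <-] <-] <-]].
    have [ix _ ixK] := xi_bij; move: dn; rewrite -(ixK y) -image_gorbit => dn.
    by exists (gorbit (ix y)) => //; split; [exists (ix y)|rewrite -degE].
  by split; [exists (xi x); rewrite // image_gorbit|rewrite degE].
rewrite card_eq_sym; apply: inj_card_eq; apply: in2W.
move=> A B AB; apply/funext => x; have xi_inj := bij_inj xi_bij.
by rewrite -(image_inj (A := A) (a := x) xi_inj) AB image_inj.
Qed.

End Equivariant.

(** * The zeta function counts orbits *)

Section Geometric.
Variable K : fieldType.
Implicit Types A : fps K.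
Local Open Scope ring_scope.

Lemma fpsM0 A B : (A * B) 0%N = A 0%N * B 0%N.
Proof. by rewrite fpsM big_ord1 subn0. Qed.

Lemma fpsMX A n : (A * fpsX K) n.+1 = A n.
Proof.
rewrite fpsM !big_ord_recr /= subnn subSnn mulr0 mulr1 addr0 big1 ?add0r //.
move=> i _; rewrite (_ : (n.+1 - i == 1)%N = false) ?mulr0 //.
by have := ltn_ord i; lia.
Qed.

Lemma fpsMXn A n : (A * fpsX K ^+ n) n = A 0%N.
Proof.
elim: n => [|n IH]; first by rewrite expr0 mulr1.
by rewrite exprSr mulrA fpsMX IH.
Qed.

(** The series g = (1 - X^n)^-1 satisfies g = 1 + g X^n. *)
Lemma fps_mul_geom A n : (0 < n)%N ->
  (A * (1 - fpsX K ^+ n)^-1) 0%N = A 0%N /\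
  (A * (1 - fpsX K ^+ n)^-1) n = A n + A 0%N.
Proof.
move=> n0; set g := _^-1.
have g0 : g 0%N = 1 by rewrite (@fps_geom_low _ n 0) ?eqxx.
split; first by rewrite fpsM0 g0 mulr1.
have gE : g = 1 + g * fpsX K ^+ n.
  have u : 1 - fpsX K ^+ n \is a GRing.unit.
    by rewrite unfold_in /= /fps_unit fpsD fpsN fps_exp_low // subr0 fps1 oner_neq0.
  by apply/eqP; rewrite -subr_eq -{1}(mulr1 g) -mulrBr mulVr.
by rewrite gE mulrDr mulr1 mulrA fpsD fpsMXn fpsM0 g0 mulr1.
Qed.

(** Each factor (1 - X^n)^-1 adds the constant term to the coefficient of X^n, so
    that coefficient reveals the exponent a when the series A is known. *)
Lemma fps_mul_geomX A n a : (0 < n)%N ->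
  (A * (1 - fpsX K ^+ n)^-1 ^+ a) 0%N = A 0%N /\
  (A * (1 - fpsX K ^+ n)^-1 ^+ a) n = A n + A 0%N *+ a.
Proof.
move=> n0; elim: a => [|a [IH0 IHn]]; first by rewrite expr0 mulr1 mulr0n addr0.
rewrite exprSr mulrA.
have [-> ->] := fps_mul_geom (A * (1 - fpsX K ^+ n)^-1 ^+ a) n0.
by rewrite IH0 IHn mulrSr addrA.
Qed.

End Geometric.

Section ZetaPart.
Variables (R : realType) (G : groupType) (M : gmodule G).
Hypothesis finM : locally_finite M.
Local Open Scope ring_scope.

Lemma orbits_deg_finite n : finite_set (orbits_deg M n).
Proof.
apply: sub_finite_set (finM.2 n) => nu [nuM <-]; split=> //.
by apply: gdegP; exact: finM.1.
Qed.

Lemma orbits_le0 : orbits_le M 0 = set0.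
Proof.
apply/seteqP; split => // nu [nuM]; rewrite leqn0 => /eqP d0.
by have := gdeg_gt0 nuM (finM.1 nu nuM); rewrite d0.
Qed.

Lemma orbits_leS n : orbits_le M n.+1 = orbits_le M n `|` orbits_deg M n.+1.
Proof.
apply/seteqP; split => nu; last first.
  by case=> -[nuM d]; split=> //; [exact: leqW|rewrite d].
move=> [nuM]; rewrite leq_eqVlt ltnS => /orP[/eqP d|d]; by [right|left].
Qed.

Lemma orbits_le_finite n : finite_set (orbits_le M n).
Proof.
elim: n => [|n IH]; first by rewrite orbits_le0.
by rewrite orbits_leS finite_setU; split=> //; exact: orbits_deg_finite.
Qed.

Definition zeta_part (n : nat) : fps R[i] :=
  \prod_(nu <- fset_set (orbits_le M n)) (1 - fpsX R[i] ^+ gdeg nu)^-1.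

Lemma zeta_part0 : zeta_part 0 = 1.
Proof. by rewrite /zeta_part orbits_le0 fset_set0 big_seq_fset0. Qed.

Lemma zeta_partS n : zeta_part n.+1 = zeta_part n *
  (1 - fpsX R[i] ^+ n.+1)^-1 ^+ #|` fset_set (orbits_deg M n.+1)|.
Proof.
have fl := orbits_le_finite; have fd := orbits_deg_finite.
rewrite /zeta_part (big_fsetID _ (mem (fset_set (orbits_le M n)))) /=.
have -> : [fset nu in fset_set (orbits_le M n.+1)
    | nu \in fset_set (orbits_le M n)]%fset = fset_set (orbits_le M n).
  apply/fsetP => nu; rewrite !inE /= !in_fset_set //.
  by rewrite orbits_leS in_setU andb_orl andbb; case: (nu \in orbits_le M n);
    rewrite ?andbF.
have -> : [fset nu in fset_set (orbits_le M n.+1)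
    | nu \notin fset_set (orbits_le M n)]%fset = fset_set (orbits_deg M n.+1).
  apply/fsetP => nu; rewrite !inE /= !in_fset_set // orbits_leS in_setU.
  case: (boolP (nu \in orbits_le M n)) => [/set_mem[_ le]|_]; last by rewrite andbT.
  by rewrite andbF; apply/esym/negP => /set_mem[_ d]; move: le; rewrite d ltnn.
congr (_ * _); rewrite big_seq.
rewrite (eq_bigr (fun=> (1 - fpsX R[i] ^+ n.+1)^-1)); last first.
  by move=> nu; rewrite in_fset_set // => /set_mem[_ ->].
by rewrite -big_seq big_const_seq count_predT -Monoid.iteropE.
Qed.

(** A finite subproduct that computes the coefficient of t^k may be enlarged to
    contain all orbits of degree at most n; the factors of larger degree are
    1 modulo t^(n+1). *)
Lemma zeta_part_coef n k : (k <= n)%N -> zeta R M k = zeta_part n k.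
Proof.
move=> kn; have [J JM] := zetaP R finM k.
have fB := orbits_le_finite n.
pose B := fset_set (orbits_le M n).
move=> /(_ (J `|` B)%fset) <-; last 2 first.
- by move=> nu /=; rewrite inE => ->.
- by move=> nu /=; rewrite inE => /orP[/JM//|]; rewrite in_fset_set // => /set_mem[].
rewrite (big_fsetID _ (mem B)) /=.
have -> : [fset x in (J `|` B) | x \in B]%fset = B.
  by apply/fsetP => x; rewrite !inE andb_orl andbb; case: (x \in B); rewrite ?orbT ?andbF.
apply: (@fps_mul_low _ _ _ n) => // {}k {}kn.
rewrite big_seq; elim/big_ind: _ k kn => [//|a b ha hb k kn|nu].
  by rewrite (@fps_mul_low _ _ _ n) // ha.
rewrite !inE => /andP[/orP[/JM nuM|->//]]; rewrite in_fset_set // => nuB.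
apply: fps_geom_low; rewrite ltnNge; apply: contra nuB => nun.
by rewrite inE.
Qed.

Lemma zeta_part_coef0 n : zeta_part n 0%N = 1.
Proof.
elim: n => [|n IH]; first by rewrite zeta_part0.
by rewrite zeta_partS (fps_mul_geomX _ _ (ltn0Sn n)).1.
Qed.

End ZetaPart.

(** The partial products of M and L up to n being equal, the coefficients of
    t^(n+1) in the two zeta functions differ by the difference of the numbers
    of orbits of degree n+1. *)
Lemma zeta_eqP (R : realType) (G : groupType) (M L : gmodule G) :
  locally_finite M -> locally_finite L ->
  zeta R M = zeta R L <-> forall n, orbits_deg M n #= orbits_deg L n.
Proof.
move=> fM fL.
have fdM := orbits_deg_finite fM; have fdL := orbits_deg_finite fL.
split=> [ML n|ML]; last first.
  have parts n : zeta_part R M n = zeta_part R L n.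
    elim: n => [|n IH]; first by rewrite !zeta_part0.
    by rewrite !zeta_partS // IH (elimT (fcard_eq _ _) (ML n.+1)).
  by apply: fpsP => n; rewrite !(zeta_part_coef R _ (leqnn n)) // parts.
have deg0 (N : gmodule G) : locally_finite N -> orbits_deg N 0 = set0.
  move=> fN; apply/seteqP; split => // nu [nuN d].
  by rewrite -(orbits_le0 fN); split=> //; rewrite d.
have step m : zeta_part R M m = zeta_part R L m ->
    orbits_deg M m.+1 #= orbits_deg L m.+1.
  move=> IH; apply/fcard_eq => //.
  have := zeta_part_coef R fM (leqnn m.+1).
  rewrite ML (zeta_part_coef R fL (leqnn m.+1)) !zeta_partS // IH.
  rewrite !(fps_mul_geomX _ _ (ltn0Sn m)).2 zeta_part_coef0 //.
  by move=> /addrI /eqP; rewrite eqr_nat => /eqP.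
have parts m : zeta_part R M m = zeta_part R L m.
  elim: m => [|m IH]; first by rewrite !zeta_part0.
  by rewrite !zeta_partS // IH (elimT (fcard_eq _ _) (step m IH)).
by case: n => [|n]; [rewrite !deg0|exact: step].
Qed.

(** * Isomorphism and zeta functions *)

Theorem corollary7 (R : realType) (C : groupType) (phi : C)
    (Cphi : infinite_cyclic_on phi)
    (M L : gmodule (profinite_completion C))
    (finM : locally_finite M) (finL : locally_finite L) :
  (exists xi : M -> L,
     bijective xi /\
     forall (g : profinite_completion C) (x : M),
       xi (gact g x) = gact g (xi x))
  <-> zeta R M = zeta R L.
Proof.
rewrite zeta_eqP //; split=> [[xi [xi_bij xi_act]] n|ML].
  exact: orbits_deg_card xi_bij xi_act n.
have [f [f_bij fD _]] := Cphi.
have [s [sF sI sS] sdeg] := orbits_deg_bij ML.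
pose Orb := {nu : set M | gorbits nu}.
(* Representatives p i of the orbits of M and q i of the corresponding orbits
   of L, both indexed by the orbits of M. *)
have /choice[p pE] : forall i : Orb, exists x, gorbit x = sval i.
  by move=> [nu nuM] /=; case: nuM => x _ xE; exists x.
have /choice[q qE] : forall i : Orb, exists y, gorbit y = s (sval i).
  by move=> [nu nuM] /=; case: (sF nu nuM) => y _ yE; exists y.
have svalI : injective (sval : Orb -> set M).
  by move=> [nu h] [nu' h'] /= e; exact: eq_exist.
have svalP (i : Orb) : gorbits (sval i) by case: i.
apply: (transversal_iso (p := p) (q := q)).
- apply: (transversal_orbits pE); split.
  + by move=> i _; exact: svalP.
  + by move=> i j _ _ /svalI.
  + by move=> nu nuM; exists (exist _ nu nuM).
- apply: (transversal_orbits qE); split.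
  + by move=> i _; exact: sF.
  + by move=> i j _ _ /sI ij; apply/svalI/ij; rewrite inE.
  + by move=> mu /sS[nu nuM <-]; exists (exist _ nu nuM).
move=> i g; apply: (stab_card f_bij fD (n := gdeg (sval i))).
  by rewrite pE; apply: gdegP; exact: finM.1.
by rewrite qE -sdeg //; apply: gdegP; apply: finL.1; exact: sF.
Qed.
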